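(* Let $V$ be a reflexive Banach space, and let $F \colon V \to \mathbb{R}$ be a G\^{a}teaux differentiable, convex functional that is semicoercive with respect to a seminorm $|\cdot|$ on $V$. Let $V = \sum_{j=1}^N V_j$ with closed subspaces $V_j$, and let $u \in V$ be a minimizer of $F$ over $V$. Suppose that for some $q > 1$ the following local smoothness condition holds for every $j \in \{1,\dots,N\}$: for any $|\cdot|$-bounded convex subset $K \subset V$ and any $\|\cdot\|$-bounded convex subset $K_j \subset V_j$ with $0 \in K_j$, $$\sup_{v \in K,\, w_j \in K_j} \frac{d_j(w_j; v)}{\|w_j\|^q} < \infty .$$ Let $\{u^{(n)}\}_{n \ge 0}$ be a sequence generated by the parallel subspace correction method with initial iterate $u^{(0)} \in V$ and step size $\tau \in (0, \tau_0]$, and let $\zeta_n = F(u^{(n)}) - F(u)$ for $n \geq 0$. If $\zeta_0 > C_{K_0} R_0^q$, then $$\zeta_1 \leq \left(1 - \tau \left( 1 - \frac{1}{q} \right) \right) \zeta_0 .$$ Otherwise, $$\zeta_n \leq \frac{C}{\left( n + (C/\zeta_0)^{1/\beta} \right)^{\beta}}, \quad n \geq 0,$$ where $$\beta = q-1, \qquad C = \left(\frac{q}{\tau}\right)^{q-1} C_{K_0} R_0^q .$$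
   Context: Semicoercivity with respect to a seminorm: $F$ is semicoercive with respect to $|\cdot|$ if $|\cdot|$ is a continuous seminorm on $V$ such that, with $\ker|\cdot| = \{v \in V : |v| = 0\}$, there is a constant $C'>0$ with $\inf_{\phi \in \ker|\cdot|} \|v+\phi\| \le C'|v|$ for all $v \in V$; $F(v)=F(v+\phi)$ for all $v \in V$, $\phi \in \ker|\cdot|$; and $F(v) \to \infty$ as $|v| \to \infty$. Write $\mathcal{N} = \ker|\cdot|$. Local functionals: for $v \in V$, $w_j \in V_j$, set $F_j(w_j;v) = F(v+w_j)$ and $d_j(w_j; v) = F_j(w_j;v) - F(v) - \langle F'(v), w_j\rangle$, where $F'(v) \in V^*$ is the G\^{a}teaux derivative and $\langle\cdot,\cdot\rangle$ the duality pairing. $\tau_0$: $\tau_0$ is the maximum of all $\tau > 0$ such that $(1-\tau N)F(v) + \tau\sum_{j=1}^N F(v+w_j) \ge F\bigl(v+\tau\sum_{j=1}^N w_j\bigr)$ for all $v \in V$ and $w_j \in V_j$; this inequality then holds for every $\tau \in (0,\tau_0]$. Parallel subspace correction method: given $u^{(0)} \in V$ and $\tau \in (0,\tau_0]$, for $n = 0,1,2,\dots$ choose $w_j^{(n+1)} \in \arg\min_{w_j \in V_j} F_j(w_j;u^{(n)})$ for each $j \in \{1,\dots,N\}$ and set $u^{(n+1)} = u^{(n)} + \tau\sum_{j=1}^N w_j^{(n+1)}$. Constants: $K_0 = \{v \in V : F(v) \le F(u^{(0)})\}$, $R_0 = \sup_{v \in K_0}|v-u|$, and for a set $K \subset V$,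 $$C_K = q \sup_{v,\, v+w \in K}\ \inf_{\phi \in \mathcal{N}}\ \inf_{\sum_{j=1}^N w_j = w+\phi,\ w_j \in V_j} \frac{\sum_{j=1}^N d_j(w_j;v)}{|w|^q}.$$ Convention: quotients $0/0$ occurring as arguments of a supremum are $0$; in $C_K$ the quotient $\bigl(\inf_\phi\inf_{(w_j)}\sum_j d_j(w_j;v)\bigr)/|w|^q$ is regarded as the argument of the supremum. If $\zeta_0 = 0$, the second bound is read as $\zeta_n = 0$. *)

(* Defs.v *)
From HB Require Import structures.
From mathcomp Require Import all_boot all_order all_algebra.
From mathcomp Require Import all_classical all_reals all_analysis.

Set Implicit Arguments.
Unset Strict Implicit.
Unset Printing Implicit Defensive.

Import Order.TTheory GRing.Theory Num.Theory.
Import numFieldNormedType.Exports.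

Local Open Scope classical_set_scope.
Local Open Scope ring_scope.

Section banach.
Context {R : realType} {V : normedModType R}.
Implicit Types (F : V -> R) (p : V -> R) (A : set V).

Definition dual : set (V -> R) :=
  [set f : V -> R^o | linear f /\ continuous f].

Definition dual_norm (f : V -> R) : R :=
  sup [set `|f v| | v in [set v | `|v| <= 1]].

(* A functional on the dual is represented by a function on all of [V -> R],
   of which only the values on [dual] matter. *)
Definition bidual : set ((V -> R) -> R) :=
  [set Phi | (forall (a : R) f g, dual f -> dual g ->
                Phi (fun v => a * f v + g v) = a * Phi f + Phi g) /\
             (exists M, forall f, dual f -> `|Phi f| <= M * dual_norm f)].

Definition reflexive_space : Prop :=
  forall Phi, bidual Phi -> exists v, forall f, dual f -> Phi f = f v.

(* The derivative F'(v) is the function ['D_^~ F v] of the direction. *)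
Definition gateaux_differentiable F : Prop :=
  forall v, (forall w, derivable F v w) /\ dual (fun w => 'D_w F v).

Definition seminorm p : Prop :=
  [/\ forall v, 0 <= p v,
      forall v w, p (v + w) <= p v + p w &
      forall a v, p (a *: v) = `|a| * p v].

Definition seminorm_ker p : set V := [set v | p v = 0].

Definition semicoercive F p : Prop :=
  [/\ seminorm p /\ continuous p,
      exists2 C', 0 < C' &
        forall v, inf [set `|v + phi| | phi in seminorm_ker p] <= C' * p v,
      forall v phi, seminorm_ker p phi -> F v = F (v + phi) &
      forall M : R, exists r : R, forall v, r <= p v -> M <= F v].

Definition closed_subspace A : Prop :=
  [/\ closed A, A 0 & forall (a : R) v w, A v -> A w -> A (a *: v + w)].

Definition minimizer A F : set V :=
  [set w | A w /\ forall z, A z -> F w <= F z].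

End banach.

Section subspace_correction.
Context {R : realType} {V : normedModType R} {N : nat}.
Implicit Types (F : V -> R) (p : V -> R) (Vs : 'I_N -> set V).

Definition local_energy F (w v : V) : R := F (v + w).

Definition local_distance F (w v : V) : R :=
  local_energy F w v - F v - 'D_w F v.

Definition decompositions Vs (v : V) : set ('I_N -> V) :=
  [set w | (forall j, Vs j (w j)) /\ \sum_(j < N) w j = v].

Definition admissible_step F Vs (tau : R) : Prop :=
  0 < tau /\
  forall v (w : 'I_N -> V), (forall j, Vs j (w j)) ->
    F (v + tau *: \sum_(j < N) w j) <=
    (1 - tau * N%:R) * F v + tau * \sum_(j < N) F (v + w j).

(* For F convex and Gateaux differentiable with a minimizer, and the Vs j
   spanning V, the supremum is a maximum unless F is constant; then every
   positive step is admissible and the supremum is +oo. *)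
Definition tau0 F Vs : \bar R :=
  ereal_sup [set tau%:E | tau in admissible_step F Vs].

Definition parallel_correction F Vs (tau : R) (u_ : nat -> V) : Prop :=
  forall n, exists w : 'I_N -> V,
    (forall j, minimizer (Vs j) (local_energy F ^~ (u_ n)) (w j)) /\
    u_ n.+1 = u_ n + tau *: \sum_(j < N) w j.

(* In the extended reals 0 / 0 = 0 * +oo = 0 and a / 0 = +oo for a > 0. *)
Definition locally_smooth F p Vs (q : R) : Prop :=
  forall (j : 'I_N) (K Kj : set V),
    [bounded p v | v in K] -> convex_set (K : set (convex_lmodType V)) ->
    Kj `<=` Vs j -> bounded_set Kj ->
    convex_set (Kj : set (convex_lmodType V)) -> Kj 0 ->
    (ereal_sup [set (local_distance F vw.2 vw.1)%:E / (`|vw.2| `^ q)%R%:E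
               | vw in K `*` Kj] < +oo)%E.

Definition sublevel F (v0 : V) : set V := [set v | F v <= F v0].

Definition level_radius p (K : set V) (u : V) : \bar R :=
  ereal_sup [set (p (v - u))%:E | v in K].

Definition C_K F p Vs (q : R) (K : set V) : \bar R :=
  (q%:E * ereal_sup
    [set ereal_inf
           [set ereal_inf
                  [set (\sum_(j < N) local_distance F (w j) vw.1)%R%:E
                  | w in decompositions Vs (vw.2 + phi)%R]
           | phi in seminorm_ker p]
         / (p vw.2 `^ q)%R%:E
    | vw in [set vw : V * V | K vw.1 /\ K (vw.1 + vw.2)%R]])%E.

End subspace_correction.

(* Main.v *)
Require Import Defs.
From HB Require Import structures.
From mathcomp Require Import all_boot all_order all_algebra.
From mathcomp Require Import all_classical all_reals all_analysis.
From mathcomp Require Import ring lra.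

Set Implicit Arguments.
Unset Strict Implicit.
Unset Printing Implicit Defensive.

Import Order.TTheory GRing.Theory Num.Theory.
Import numFieldNormedType.Exports.

Local Open Scope classical_set_scope.
Local Open Scope ring_scope.

(** Let zeta_n be the energy gap of the n-th iterate, S the supremum in the
constant C_K for K the initial sublevel set, r the radius of that set, and
T = q S r^q.

One step of the method decreases the energy at least as much as the best
decomposed correction: an admissible step size bounds the new energy by the
average of the energies of the local corrections, these are local minimizers,
and any other choice of local corrections summing to w + phi, with phi in the
kernel of the seminorm, turns this average into the derivative of F in the
direction w (the derivative along phi vanishes) plus a sum of local distances
([correction_decrease]).  For w = t (u - u_n) with t in [0, 1], convexity bounds
the derivative by - t zeta_n, and the definition of S bounds the best sum of
local distances by S (t r)^q ([correction_descent]).  Hence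
[zeta_(n+1) <= zeta_n - tau (t zeta_n - t^q T / q)] for all t in [0, 1].
If zeta_0 > T, then t = 1 gives the first bound.  Otherwise zeta_n <= T for
all n, and the optimal t = (zeta_n / T)^(1 / (q - 1)) gives the recursion
[a_(n+1) <= a_n - b a_n (a_n / C)^(1 / b)] with b = q - 1 ([powR_descent]).
It says that (C / a_n)^(1 / b) grows by at least 1 per step, by Bernoulli's
inequality ([powR_decay]).

The bounds are about real numbers only if S and r are finite.  For r this is
coercivity.  For S ([C_K_fin]), the local smoothness condition bounds local
distances by a multiple of the q-th power of the norm, but only on bounded sets
of local corrections, so that every direction w must have a decomposition,
modulo the kernel, whose terms are bounded by a multiple of the seminorm of w.
Semicoercivity provides a representative of w modulo the kernel of comparable
norm, and the open mapping theorem for the sum map from the product of the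
closed subspaces to the Banach space V provides the decomposition
([stable_decomposition]).  It is proved directly: by Baire's theorem the sums of
bounded local terms are somewhere dense, so every vector is, up to half its
norm, a sum of comparable terms, and iterating on the remainder gives series
that converge in each subspace. *)

(** * Convex Gateaux differentiable functionals *)

Section convex_functional.
Context {R : realType} {V : normedModType R}.
Implicit Types (F p : V -> R) (v w : V).

Lemma convex_function_segment F v w (t : R) :
  convex_function [set: convex_lmodType V] F -> 0 <= t -> t <= 1 ->
  F (v + t *: w) <= F v + t * (F (v + w) - F v).
Proof.
move=> Fc t0 t1.
have := Fc (Itv01 t0 t1) (v + w) v (mem_setT _) (mem_setT _).
rewrite [X in F X](_ : _ = v + t *: w); last first.
  rewrite /conv /= /unstable.onem scalerBl scale1r scalerDr.
  by rewrite addrC addrA subrK.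
rewrite convRE /= /unstable.onem => /le_trans; apply.
by rewrite le_eqVlt; apply/orP; left; apply/eqP; ring.
Qed.

Lemma convex_setP (A : set V) :
  (forall v w (t : R), A v -> A w -> 0 <= t -> t <= 1 ->
     A (t *: v + (1 - t) *: w)) ->
  convex_set (A : set (convex_lmodType V)).
Proof.
move=> Ac v w t /set_mem Av /set_mem Aw; apply/mem_set.
exact: (Ac v w t%:num Av Aw (ge0 t) (le1 t)).
Qed.

Lemma convex_sublevel F v0 :
  convex_function [set: convex_lmodType V] F ->
  convex_set (sublevel F v0 : set (convex_lmodType V)).
Proof.
move=> Fc; apply: convex_setP => v w t; rewrite /sublevel /= => Fv Fw t0 t1.
have -> : t *: v + (1 - t) *: w = w + t *: (v - w).
  by rewrite scalerBl scale1r scalerBr addrCA.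
apply: (le_trans (convex_function_segment _ _ Fc t0 t1)).
rewrite [w + _]addrC subrK; nra.
Qed.

(** The difference quotients along a ray increase with the step, so that the
one with step 1 bounds the derivative. *)
Lemma convex_derive_le F v w :
  convex_function [set: convex_lmodType V] F -> derivable F v w ->
  F v + 'D_w F v <= F (v + w).
Proof.
move=> Fc dF; rewrite -lerBrDl.
have cF := cvg_dnbhs_at_right dF.
rewrite /derive -(cvg_lim (@norm_hausdorff _ _) cF).
apply: limr_le; first by apply: cvgP cF.
near=> h => /=.
have h0 : 0 < h by near: h; exact: nbhs_right_gt.
have h1 : h <= 1 by near: h; exact: nbhs_right_le.
rewrite ler_pdivrMl// lerBlDr [leRHS]addrC [h *: w + v]addrC.
exact: convex_function_segment (ltW h0) h1.
Unshelve. all: by end_near. Qed.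

Lemma local_distance_ge0 F v w :
  convex_function [set: convex_lmodType V] F -> gateaux_differentiable F ->
  0 <= local_distance F w v.
Proof.
move=> Fc dF; rewrite /local_distance /local_energy -addrA -opprD subr_ge0.
exact: convex_derive_le Fc ((dF v).1 w).
Qed.

Lemma gateaux_deriveD F v w w' : gateaux_differentiable F ->
  'D_(w + w') F v = 'D_w F v + 'D_w' F v.
Proof.
by move=> /(_ v)[_ [lin _]]; have := lin 1 w w'; rewrite !scale1r.
Qed.

Lemma gateaux_derive0 F v : gateaux_differentiable F -> 'D_0 F v = 0.
Proof.
move=> dF; have := gateaux_deriveD v 0 0 dF.
by rewrite addr0 => /eqP; rewrite -subr_eq0 opprD addNKr oppr_eq0 => /eqP.
Qed.

Lemma gateaux_deriveZ F v w (a : R) : gateaux_differentiable F ->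
  'D_(a *: w) F v = a * 'D_w F v.
Proof.
move=> dF; have [_ [lin _]] := dF v; have := lin a w 0.
by rewrite /= gateaux_derive0// !addr0.
Qed.

Lemma gateaux_derive_sum (I : Type) (s : seq I) F v (w : I -> V) :
  gateaux_differentiable F ->
  'D_(\sum_(j <- s) w j) F v = \sum_(j <- s) 'D_(w j) F v.
Proof.
move=> dF; elim: s => [|j s ih]; first by rewrite !big_nil gateaux_derive0.
by rewrite !big_cons gateaux_deriveD// ih.
Qed.

Lemma local_distance0 F v : gateaux_differentiable F ->
  local_distance F 0 v = 0.
Proof.
move=> dF; rewrite /local_distance /local_energy addr0 gateaux_derive0//.
by rewrite subr0 subrr.
Qed.

(** The supporting hyperplane lies below [F] in the directions [phi] and
[- phi], along which [F] is constant. *)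
Lemma derive_invariant F v phi :
  convex_function [set: convex_lmodType V] F -> gateaux_differentiable F ->
  F (v + phi) = F v -> F (v - phi) = F v -> 'D_phi F v = 0.
Proof.
move=> Fc dF Fp Fm.
have := convex_derive_le Fc ((dF v).1 phi).
have := convex_derive_le Fc ((dF v).1 (- phi)).
rewrite Fp Fm !gerDl -scaleN1r gateaux_deriveZ// mulN1r oppr_le0 => D1 D2.
by apply/le_anti; rewrite D1 D2.
Qed.

(** * Admissible step sizes *)

Section admissible_steps.
Context {N : nat} (Vs : 'I_N -> set V).

(** Admissibility passes to smaller steps by convexity along the segment from
[v] to [v + tau' *: s]. *)
Lemma admissible_step_le F (tau tau' : R) :
  convex_function [set: convex_lmodType V] F ->
  0 < tau -> tau <= tau' -> admissible_step F Vs tau' ->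
  admissible_step F Vs tau.
Proof.
move=> Fc tau_gt0 tau_le [tau'_gt0 adm]; split => // v w Vw.
have t0 : 0 <= tau / tau' by rewrite divr_ge0// ltW.
have t1 : tau / tau' <= 1 by rewrite ler_pdivrMr// mul1r.
have := convex_function_segment v (tau' *: \sum_(j < N) w j) Fc t0 t1.
rewrite scalerA divfK ?gt_eqF// => /le_trans; apply.
have := ler_wpM2l t0 (lerB (adm v w Vw) (lexx (F v))).
rewrite -(lerD2l (F v)) => /le_trans; apply.
rewrite le_eqVlt; apply/orP; left; apply/eqP.
by field; rewrite gt_eqF.
Qed.

(** At the limit step the tangent inequality at [v + tau *: s] compares
[F (v + tau *: s)] with the values at slightly smaller steps, up to an error
linear in the difference of the steps. *)
Lemma admissible_step_tau0 F (tau : R) :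
  convex_function [set: convex_lmodType V] F -> gateaux_differentiable F ->
  0 < tau -> (tau%:E <= tau0 F Vs)%E -> admissible_step F Vs tau.
Proof.
move=> Fc dF tau_gt0 tau_le.
have adm (t : R) : 0 < t -> t < tau -> admissible_step F Vs t.
  move=> t0 tlt.
  have /ereal_sup_gt[_ [t' at' <-]] : (t%:E < tau0 F Vs)%E.
    by apply: lt_le_trans tau_le; rewrite lte_fin.
  rewrite lte_fin => /ltW tt'.
  exact: admissible_step_le tt' at'.
split => // v w Vw; set s := \sum_(j < N) w j.
set S := \sum_(j < N) F (v + w j); set D := 'D_s F (v + tau *: s).
set B := `|- N%:R * F v + S| + `|D| + 1.
have B0 : 0 < B by rewrite ltr_wpDl// addr_ge0.
apply/ler_addgt0Pr => e e0.
(* A step back by h costs at most h * B, where B bounds the slopes in play. *)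
set h := Num.min (tau / 2) (e / B).
have h0 : 0 < h by rewrite lt_min !divr_gt0.
have htau : h < tau by rewrite gt_min; apply/orP; left; lra.
have hB : h * B <= e by rewrite -ler_pdivlMr// ge_min lexx orbT.
have [||_ /(_ v w Vw)] := adm (tau - h); [lra|lra|rewrite -/s -/S => admh].
have := convex_derive_le Fc ((dF (v + tau *: s)).1 (- h *: s)).
rewrite gateaux_deriveZ// -addrA -scalerDl => tangent.
have D1 := ler_norm D; have D2 := ler_norm (- (- N%:R * F v + S)).
rewrite normrN in D2; rewrite -/D in tangent.
rewrite /B in hB; nra.
Qed.

End admissible_steps.
End convex_functional.

(** * Stable decompositions over a sum of closed subspaces *)

Section stable_decomposition.
Context {R : realType} {V : completeNormedModType R} {N : nat}.
Variable Vs : 'I_N -> set V.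
Hypothesis Vs_subspace : forall j, closed_subspace (Vs j).
Hypothesis Vs_sum : forall v, decompositions Vs v !=set0.

Definition bounded_sums (k : R) : set V :=
  [set v | exists2 w, decompositions Vs v w & forall j, `|w j| <= k].

Lemma bounded_sums_lin (k l a : R) v w :
  bounded_sums k v -> bounded_sums l w ->
  bounded_sums (`|a| * k + l) (a *: v + w).
Proof.
move=> [v' [Vv sv] kv] [w' [Vw sw] lw].
exists (fun j => a *: v' j + w' j); first split.
- by move=> j; have [_ _ lin] := Vs_subspace j; exact: lin.
- by rewrite big_split /= -scaler_sumr sv sw.
- move=> j; rewrite (le_trans (ler_normD _ _))// normrZ lerD//.
  by rewrite ler_wpM2l.
Qed.

Lemma bounded_sums0 : bounded_sums 0 0.
Proof.
exists (fun=> 0); last by move=> j; rewrite normr0.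
by split; [move=> j; have [] := Vs_subspace j | rewrite big1].
Qed.

Lemma bounded_sums_le (k l : R) v : k <= l ->
  bounded_sums k v -> bounded_sums l v.
Proof. by move=> kl [w Vw wk]; exists w => // j; exact: le_trans (wk j) kl. Qed.

(** The sets of sums with terms bounded by an integer cover the space; Baire's
theorem forbids that the complements of their closures are all dense. *)
Lemma bounded_sums_somewhere_dense : exists (n : nat) (x : V) (r : R),
  0 < r /\ ball x r `<=` closure (bounded_sums n%:R).
Proof.
set O := fun n => ~` closure (bounded_sums n%:R).
have [n nd] : exists n, ~ dense (O n).
  apply: contrapT => /forallNP dO.
  have /(_ setT) : dense (\bigcap_i O i).
    apply: Baire => i; split; last exact: contrapT.
    by rewrite openC; exact: closed_closure.
  case=> [||v [_ Ov]]; [by exists 0 | exact: openT |].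
  have [w Vw] := Vs_sum v.
  set m := (Num.truncn (\sum_j `|w j|)).+1.
  apply: (Ov m I); apply: subset_closure; exists w => // j.
  have : \sum_i `|w i| <= m%:R by apply/ltW; exact: truncnS_gt.
  by apply: le_trans; rewrite (bigD1 j)//= lerDl sumr_ge0.
have [D [Dne oD DO]] : exists D, [/\ D !=set0, open D & D `&` O n = set0].
  apply: contrapT => H; apply: nd => D Dne oD.
  by apply/set0P/eqP => D0; apply: H; exists D.
have [x Dx] := Dne.
have /nbhs_ballP[r /= r0 sub] : nbhs x D by exact: open_nbhs_nbhs.
exists n, x, r; split=> // y /sub Dy.
by apply: contrapT => ny; have : (D `&` O n) y by []; rewrite DO.
Qed.

(** Points of the ball where bounded sums are dense, and its center, are both
approximated by bounded sums; by linearity so are the differences, which fill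
a ball around 0, and by homogeneity all vectors.  The relative error 1/2 is
what makes the remainders below a geometric sequence. *)
Lemma bounded_sums_approx : exists2 M : R, 0 < M &
  forall v, exists2 a, bounded_sums (M * `|v|) a & `|v - a| <= `|v| / 2.
Proof.
have [n [x [r [r0 xr]]]] := bounded_sums_somewhere_dense.
have approx y e : ball x r y -> 0 < e ->
    exists2 a, bounded_sums n%:R a & `|y - a| < e.
  move=> /xr/(_ (ball y e) (nbhsx_ballx _ _ _)) H e0.
  by have [a [Aa]] := H e0; rewrite -ball_normE /=; exists a.
exists (n.+1%:R * 4 / r); first by rewrite divr_gt0// mulr_gt0.
move=> v; have [->|v0] := eqVneq v 0.
  exists 0; last by rewrite subr0 normr0 mul0r.
  by rewrite normr0 mulr0; exact: bounded_sums0.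
have nv : 0 < `|v| by rewrite normr_gt0.
(* The factor c scales v to half of the radius, so that an error of r / 8 at
   each end becomes `|v| / 2 after scaling back. *)
set c := r / (2 * `|v|).
have c0 : 0 < c by rewrite divr_gt0// mulr_gt0.
have e0 : 0 < r / 8 by rewrite divr_gt0.
have bv : ball x r (x + c *: v).
  rewrite -ball_normE /= opprD addNKr normrN normrZ gtr0_norm//.
  have -> : c * `|v| = r / 2 by rewrite /c; field; rewrite gt_eqF.
  lra.
have [a Aa xa] := approx _ _ bv e0.
have [b Ab xb] := approx _ _ (ballxx x r0) e0.
exists (c^-1 *: (a - b)).
  have := bounded_sums_lin c^-1 (bounded_sums_lin (-1) Ab Aa) bounded_sums0.
  rewrite !addr0 scaleN1r [- b + a]addrC; apply: bounded_sums_le.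
  rewrite normrN1 mul1r gtr0_norm ?invr_gt0// /c invf_div.
  have -> : 2 * `|v| / r * (n%:R + n%:R) = n%:R * 4 / r * `|v| by ring.
  by rewrite !ler_wpM2r ?invr_ge0 ?ler_nat// ltW.
have -> : v - c^-1 *: (a - b) = c^-1 *: ((x + c *: v - a) - (x - b)).
  have -> : x + c *: v - a - (x - b) = c *: v - (a - b).
    by rewrite -[x + _ - a]addrA !opprD addrACA subrr add0r addrA.
  by rewrite [RHS]scalerBr scalerA mulVf ?gt_eqF// scale1r.
rewrite normrZ gtr0_norm ?invr_gt0// ler_pdivrMl//.
rewrite (le_trans (ler_normB _ _))// (_ : c * _ = r / 8 + r / 8).
  by rewrite lerD// ltW.
by rewrite /c; field; rewrite gt_eqF.
Qed.

(** The open mapping theorem for the sum map: each remainder is approximated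
again, and the terms chosen in one subspace form a series dominated by a
geometric one, whose sum stays in this closed subspace. *)
Lemma stable_decomposition : exists2 C : R, 0 < C &
  forall v, exists2 w, decompositions Vs v w & forall j, `|w j| <= C * `|v|.
Proof.
have [M M0 approx] := bounded_sums_approx.
have /choice[A /all_and2[AM Av]] : forall v, exists a,
    bounded_sums (M * `|v|) a /\ `|v - a| <= `|v| / 2.
  by move=> v; have [a] := approx v; exists a.
exists (2 * M); first by rewrite mulr_gt0.
have /choice[W HW] : forall v, exists w : 'I_N -> V,
    decompositions Vs (A v) w /\ forall j, `|w j| <= M * `|v|.
  by move=> v; have [w] := AM v; exists w.
move=> v; pose res n := iter n (fun x => x - A x) v.
have resE n : `|res n| <= `|v| / 2 ^+ n.
  elim: n => [|n ih]; first by rewrite expr0 divr1.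
  rewrite (le_trans (Av (res n)))// exprSr invfM mulrA ler_wpM2r//.
pose term j n := W (res n) j.
have termE j n : `|term j n| <= geometric (M * `|v|) 2^-1 n.
  have [_ /(_ j)] := HW (res n); move/le_trans; apply.
  by rewrite /geometric /= exprVn -mulrA ler_wpM2l ?(ltW M0)// resE.
have norm2 : `|2^-1 : R| < 1 by rewrite gtr0_norm ?invf_lt1 ?ltr1n.
have cvg_term j : cvgn (series (term j)).
  apply: normed_cvg; apply: (series_le_cvg _ _ (termE j)).
  - by move=> n; exact: normr_ge0.
  - move=> n; rewrite /geometric /= mulr_ge0 ?exprn_ge0 ?invr_ge0//.
    by rewrite mulr_ge0// ltW.
  - exact: is_cvg_geometric_series.
pose w j := limn (series (term j)).
have sum_res n : \sum_(j < N) series (term j) n = v - res n.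
  elim: n => [|n ih].
    by rewrite /res /= subrr big1// => j _; rewrite /series /= big_nil.
  under eq_bigr do rewrite seriesSr.
  rewrite big_split /= ih; have [[_ ->] _] := HW (res n).
  by rewrite /res /= opprB addrA addrAC.
exists w; first split.
- move=> j; have [cl V0 lin] := Vs_subspace j.
  apply: (closed_cvg (Vs j) cl _ _ (cvg_term j)); apply: nearW => n.
  elim: n => [|n ih]; first by rewrite /series /= big_nil.
  rewrite seriesSr addrC -[term j n]scale1r; apply: lin => //.
  by have [[]] := HW (res n).
- have lim1 : \sum_(j < N) series (term j) n @[n --> \oo] --> \sum_(j < N) w j.
    by apply: cvg_big => [|j _]; [exact: add_continuous | exact: cvg_term].
  have res0 : res n @[n --> \oo] --> (0 : V).
    apply/norm_cvg0P; apply: (@squeeze_cvgr _ _ _ _ (cst 0) (geometric `|v| 2^-1)).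
    + by apply: nearW => n; rewrite normr_ge0 /geometric /= exprVn resE.
    + exact: cvg_cst.
    + exact: cvg_geometric.
  have lim2 : \sum_(j < N) series (term j) n @[n --> \oo] --> v.
    under eq_fun do rewrite sum_res.
    rewrite -[X in nbhs X]subr0; apply: cvgB => //; exact: cvg_cst.
  rewrite -(cvg_lim (@norm_hausdorff _ _) lim1).
  exact: (cvg_lim (@norm_hausdorff _ _) lim2).
- move=> j.
  have cn : `|series (term j) n| @[n --> \oo] --> `|w j|.
    exact: cvg_norm (cvg_term j).
  rewrite -(cvg_lim (@norm_hausdorff _ _) cn).
  apply: limr_le; first by apply: cvgP cn.
  apply: nearW => n.
  rewrite /series /= (le_trans (ler_norm_sum _ _ _))//.
  rewrite (le_trans (ler_sum _ (fun i _ => termE j i)))//.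
  have Mv0 : 0 <= M * `|v| by rewrite mulr_ge0// ltW.
  have half_gt0 : 0 < 2^-1 :> R by [].
  rewrite (le_trans (geometric_le_lim n Mv0 half_gt0 norm2))//.
  by rewrite le_eqVlt; apply/orP; left; apply/eqP; field.
Qed.
End stable_decomposition.

(** * The scalar recursion *)

Section scalar_recurrence.
Context {R : realType}.
Implicit Types (b x : R).

(** Bernoulli's inequality for the negative exponent [- b], by comparing both
sides with [expR (- (b * x))]. *)
Lemma powR_bernoulli x b : 0 <= x -> 0 <= b -> 1 - b * x <= ((1 + x) `^ b)^-1.
Proof.
move=> x0 b0; rewrite -powRN /powR; case: ifPn => [/eqP|_]; first lra.
have lnx : ln (1 + x) <= x by rewrite le_ln1Dx; lra.
rewrite (le_trans (expR_ge1Dx (- (b * x))))// ler_expR mulNr lerN2.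
by rewrite ler_wpM2l.
Qed.

Lemma powRV x b : 0 <= x -> x^-1 `^ b = (x `^ b)^-1.
Proof. by move=> x0; rewrite -powR_inv1// powRAC powR_inv1// powR_ge0. Qed.

(** With [x n := (C / a n) `^ b^-1] the hypothesis reads
[a n.+1 <= a n * (1 - b / x n)], and Bernoulli's inequality turns it into
[x n.+1 >= x n + 1]. *)
Lemma powR_decay (b C : R) (a : nat -> R) : 0 < b -> 0 < C -> 0 < a 0%N ->
  (forall n, 0 <= a n) ->
  (forall n, a n.+1 <= a n - b * a n * (a n / C) `^ b^-1) ->
  forall n, a n <= C / (n%:R + (C / a 0%N) `^ b^-1) `^ b.
Proof.
move=> b0 C0 a00 a_ge0 rec.
set s0 := (C / a 0%N) `^ b^-1.
have s00 : 0 < s0 by rewrite powR_gt0// divr_gt0.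
have rootK y : 0 < y -> C / ((C / y) `^ b^-1) `^ b = y.
  move=> y0; have y1 : 0 <= C / y by rewrite divr_ge0// ltW.
  by rewrite -powRrM mulVf ?gt_eqF// powRr1// invf_div mulrCA mulfV ?mulr1 ?gt_eqF.
elim=> [|n ih].
  by rewrite add0r rootK.
(* Once the sequence hits 0, [x n] is no longer meaningful. *)
have [an0|an0] := leP (a n.+1) 0.
  by rewrite (le_trans an0)// divr_ge0 ?powR_ge0// ltW.
have an : 0 < a n.
  apply: (lt_le_trans an0); rewrite (le_trans (rec n))// gerBl.
  by rewrite !mulr_ge0 ?powR_ge0 ?a_ge0// ltW.
set s := n%:R + s0; have s_gt0 : 0 < s by rewrite ltr_wpDl.
set x := (C / a n) `^ b^-1.
have x0 : 0 < x by rewrite powR_gt0// divr_gt0.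
have anE : a n = C / x `^ b by rewrite rootK.
have sx : s <= x.
  rewrite leNgt; apply/negP => xs.
  have : x `^ b < s `^ b by apply: gt0_ltr_powR => //; rewrite nnegrE ltW.
  have sb0 : 0 < s `^ b by rewrite powR_gt0.
  have xb0 : 0 < x `^ b by rewrite powR_gt0.
  by rewrite ltNge -lef_pV2 ?posrE// -(ler_pM2l C0) -anE ih.
have xV : (a n / C) `^ b^-1 = x^-1.
  by rewrite -invf_div powRV// divr_ge0// ltW.
rewrite (le_trans (rec n))// xV.
have -> : a n - b * a n * x^-1 = a n * (1 - b * x^-1) by ring.
have xV0 : 0 <= x^-1 by rewrite invr_ge0 ltW.
rewrite (le_trans (ler_wpM2l (a_ge0 n) (powR_bernoulli xV0 (ltW b0))))//.
rewrite anE -mulrA -invfM -powRM ?(ltW x0) ?addr_ge0// mulrDr mulr1.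
have x1 : 0 < x + 1 by rewrite addr_gt0.
have s1 : 0 < n.+1%:R + s0 by rewrite addr_gt0.
rewrite mulfV ?gt_eqF// ler_pM2l// lef_pV2 ?posrE ?powR_gt0//.
apply: ge0_ler_powR; rewrite ?nnegrE ?(ltW b0) ?(ltW x1) ?(ltW s1)//.
by rewrite -natr1 addrAC lerD2r.
Qed.

(** The bound is smallest for [t `^ (q - 1) = a / S], a choice that [a <= S]
keeps in the unit interval. *)
Lemma powR_descent (q tau S a a' : R) : 1 < q -> 0 < tau -> 0 < S ->
  0 <= a -> a <= S ->
  (forall t, 0 <= t -> t <= 1 -> a' <= a - tau * (t * a - t `^ q * S / q)) ->
  a' <= a - (q - 1) * a * (a / ((q / tau) `^ (q - 1) * S)) `^ (q - 1)^-1.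
Proof.
move=> q1 tau0 S0 a0 aS descent.
have q0 : 0 < q by lra.
have b0 : 0 < q - 1 by lra.
set t := (a / S) `^ (q - 1)^-1.
have t0 : 0 <= t by exact: powR_ge0.
have aS0 : 0 <= a / S by rewrite divr_ge0// ltW.
have t1 : t <= 1.
  have -> : 1 = 1 `^ (q - 1)^-1 :> R by rewrite powR1.
  apply: ge0_ler_powR; rewrite ?nnegrE ?invr_ge0 ?(ltW b0)//.
  by rewrite ler_pdivrMr// mul1r.
have tq : t `^ q = t * (a / S).
  rewrite -(mulr_powRB1 t0 q0); congr (_ * _).
  by rewrite /t -powRrM mulVf ?gt_eqF// powRr1.
have -> : (a / ((q / tau) `^ (q - 1) * S)) `^ (q - 1)^-1 = t * (tau / q).
  have -> : a / ((q / tau) `^ (q - 1) * S) = (a / S) * (tau / q) `^ (q - 1).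
    rewrite invfM mulrA mulrAC -[tau / q]invf_div; congr (_ * _).
    by rewrite powRV// divr_ge0// ltW.
  rewrite powRM ?powR_ge0// -powRrM mulfV ?gt_eqF// powRr1//.
  by rewrite divr_ge0 ?ltW.
rewrite (le_trans (descent t t0 t1))// tq le_eqVlt; apply/orP; left; apply/eqP.
by field; rewrite !gt_eqF.
Qed.
End scalar_recurrence.

(** * Semicoercive functionals *)

Section semicoercive_functional.
Context {R : realType} {V : normedModType R}.
Implicit Types (F p : V -> R) (u v w : V).

Lemma seminorm0 p : seminorm p -> p 0 = 0.
Proof. by case=> _ _ pZ; rewrite -(scale0r 0) pZ normr0 mul0r. Qed.

Lemma seminormN p v : seminorm p -> p (- v) = p v.
Proof. by case=> _ _ pZ; rewrite -scaleN1r pZ normrN1 mul1r. Qed.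

Lemma seminorm_sublevel_bounded F p v0 : semicoercive F p ->
  exists r, forall v, sublevel F v0 v -> p v < r.
Proof.
move=> [_ _ _ coer]; have [r Fr] := coer (F v0 + 1); exists r => v Fv.
rewrite ltNge; apply/negP => /Fr; rewrite leNgt => /negP; apply.
by rewrite (le_lt_trans Fv)// ltrDl.
Qed.

Lemma level_radius_fin F p v0 u : semicoercive F p ->
  exists2 r, level_radius p (sublevel F v0) u = r%:E & 0 <= r.
Proof.
move=> sc; have [[sn _] _ _ _] := sc; have [p_ge0 pD _] := sn.
have [r pr] := seminorm_sublevel_bounded v0 sc.
have ub : (level_radius p (sublevel F v0) u <= (r + p u)%:E)%E.
  apply: ge_ereal_sup => _ [v Kv <-]; rewrite lee_fin.
  rewrite (le_trans (pD _ _))// seminormN// lerD2r ltW//.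
  exact: pr.
have lb : (0 <= level_radius p (sublevel F v0) u)%E.
  apply: (@le_trans _ _ (p (v0 - u))%:E); first by rewrite lee_fin.
  by apply: ereal_sup_ubound; exists v0 => //; exact: lexx.
case: (level_radius _ _ _) ub lb => //= s _; rewrite lee_fin => s0.
by exists s.
Qed.

Lemma level_radius_ubound F p v0 u r :
  level_radius p (sublevel F v0) u = r%:E ->
  forall v, sublevel F v0 v -> p (v - u) <= r.
Proof.
by move=> rE v Kv; rewrite -lee_fin -rE; apply: ereal_sup_ubound; exists v.
Qed.

Lemma derive_seminorm_ker F p v phi : semicoercive F p ->
  convex_function [set: convex_lmodType V] F -> gateaux_differentiable F ->
  seminorm_ker p phi -> 'D_phi F v = 0.
Proof.
move=> [[sn _] _ inv _] Fc dF kphi; apply: derive_invariant => //.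
  by rewrite -inv.
by rewrite -inv// /seminorm_ker /= seminormN.
Qed.

(** Doubling the constant leaves room to replace the infimum over the class of
[v] by one of its elements.  If [p v = 0] there is no such room: the infimum is
then 0, and is dealt with by [splitting_cost_ker]. *)
Lemma semicoercive_representative F p : semicoercive F p ->
  exists2 C : R, 0 < C & forall v, 0 < p v ->
    exists2 phi, seminorm_ker p phi & `|v + phi| <= C * p v.
Proof.
move=> [[sn _] [C C0 Cp] _ _]; exists (2 * C); first by rewrite mulr_gt0.
move=> v pv0.
have [||_ [phi kphi <-]] := @inf_lt _ [set `|v + phi| | phi in seminorm_ker p]
   (2 * C * p v).
- by exists `|v + 0|, 0 => //; exact: seminorm0.
- apply: (le_lt_trans (Cp v)); rewrite -mulrA ltr_pMl ?ltr1n//.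
  exact: mulr_gt0.
- by move=> /ltW; exists phi.
Qed.

End semicoercive_functional.

(** * The cost of splitting a direction *)

Section splitting.
Context {R : realType} {V : normedModType R} {N : nat}.
Variables (F p : V -> R) (Vs : 'I_N -> set V) (q : R) (u0 : V).
Hypothesis F_diff : gateaux_differentiable F.
Hypothesis F_convex : convex_function [set: convex_lmodType V] F.
Hypothesis F_sc : semicoercive F p.
Hypothesis Vs_subspace : forall j, closed_subspace (Vs j).
Hypothesis q_gt1 : 1 < q.

(** This is the numerator of the quotient whose supremum defines [C_K]. *)
Definition splitting_cost v w : \bar R :=
  ereal_inf
    [set ereal_inf [set (\sum_(j < N) local_distance F (w' j) v)%:E
                   | w' in decompositions Vs (w + phi)]
    | phi in seminorm_ker p].

Let p_ge0 v : 0 <= p v. Proof. by have [[[ge0 _ _] _] _ _ _] := F_sc; exact: ge0. Qed.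

Lemma splitting_cost_le v w phi w' : seminorm_ker p phi ->
  decompositions Vs (w + phi) w' ->
  (splitting_cost v w <= (\sum_(j < N) local_distance F (w' j) v)%:E)%E.
Proof.
move=> kphi dw; apply: ge_ereal_inf; eexists; first by exists phi.
by apply: ereal_inf_lbound; exists w'.
Qed.

Lemma splitting_cost_ge0 v w : (0 <= splitting_cost v w)%E.
Proof.
apply: le_ereal_inf_tmp => _ [phi _ <-].
apply: le_ereal_inf_tmp => _ [w' _ <-]; rewrite lee_fin.
by apply: sumr_ge0 => j _; exact: local_distance_ge0.
Qed.

(** A direction in the kernel is split, modulo the kernel, into zeros. *)
Lemma splitting_cost_ker v w : p w = 0 -> splitting_cost v w = 0%E.
Proof.
move=> pw; apply/eqP; rewrite eq_le splitting_cost_ge0 andbT.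
have [[sn _] _ _ _] := F_sc.
have kw : seminorm_ker p (- w) by rewrite /seminorm_ker /= seminormN.
have d0 : decompositions Vs (w + - w) (fun=> 0).
  rewrite subrr; split; last by rewrite big1.
  by move=> j; have [] := Vs_subspace j.
apply: (le_trans (splitting_cost_le v kw d0)).
by rewrite big1// => j _; rewrite local_distance0.
Qed.

Lemma splitting_cost_near v w (c e : R) : (splitting_cost v w <= c%:E)%E ->
  0 < e -> exists2 phi, seminorm_ker p phi &
    exists2 w', decompositions Vs (w + phi) w' &
      \sum_(j < N) local_distance F (w' j) v <= c + e.
Proof.
move=> cost e0.
have /ereal_inf_lt[_ [phi kphi <-]] : (splitting_cost v w < (c + e)%:E)%E.
  by apply: (le_lt_trans cost); rewrite lte_fin ltrDl.
move=> /ereal_inf_lt[_ [w' dw <-]]; rewrite lte_fin => /ltW le.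
by exists phi => //; exists w'.
Qed.

(** The finite suprema of the local smoothness condition are summed over the
subspaces to get a common constant. *)
Lemma local_distance_powR_bound (M : R) : locally_smooth F p Vs q ->
  exists2 L : R, 0 <= L & forall j v w, sublevel F u0 v -> Vs j w ->
    `|w| <= M -> local_distance F w v <= L * `|w| `^ q.
Proof.
move=> smooth.
have q0 : q != 0 by rewrite gt_eqF// (lt_trans _ q_gt1).
have /choice[L L_le] : forall j, exists l : R, 0 <= l /\
    forall v w, sublevel F u0 v -> Vs j w -> `|w| <= M ->
      local_distance F w v <= l * `|w| `^ q.
  move=> j; have [_ Vj0 lin] := Vs_subspace j.
  (* The maximum keeps 0 in Kj when M is negative. *)
  set Kj := [set w | Vs j w /\ `|w| <= Num.max M 0].
  have /(smooth j (sublevel F u0) Kj) : [bounded p v | v in sublevel F u0].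
    have [r pr] := seminorm_sublevel_bounded u0 F_sc.
    exists r; split; first exact: num_real.
    by move=> m rm v Kv; rewrite /= ger0_norm// ltW// (lt_trans _ rm)//; exact: pr.
  set s := ereal_sup _ => fin.
  have {fin} s_lt : (s < +oo)%E.
    apply: fin.
    - exact: convex_sublevel.
    - by move=> w [].
    - exists (Num.max M 0); split; first exact: num_real.
      by move=> m Mm w [_ wM]; exact: le_trans wM (ltW Mm).
    - apply: convex_setP => v w t [Vv vM] [Vw wM] t0 t1; split.
        by apply: (lin) => //; rewrite -[_ *: w]addr0; exact: (lin).
      have t1' : 0 <= 1 - t by rewrite subr_ge0.
      rewrite (le_trans (ler_normD _ _))// !normrZ !ger0_norm//.
      have := ler_wpM2l t0 vM; have := ler_wpM2l t1' wM; lra.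
    - by split=> //; rewrite normr0 le_max lexx orbT.
  have s_ub v w : sublevel F u0 v -> Kj w ->
      ((local_distance F w v)%:E / (`|w| `^ q)%:E <= s)%E.
    by move=> Kv Kw; apply: ereal_sup_ubound; exists (v, w).
  have s_ge0 : (0 <= s)%E.
    have := s_ub u0 0 (lexx _); rewrite local_distance0// mul0e; apply.
    by split=> //; rewrite normr0 le_max lexx orbT.
  case: s s_lt s_ge0 s_ub => // l _; rewrite lee_fin => l0 l_ub.
  exists l; split=> // v w Kv Vw wM.
  have [->|w0] := eqVneq w 0.
    by rewrite local_distance0// normr0 powR0// mulr0.
  have wq : 0 < `|w| `^ q by rewrite powR_gt0// normr_gt0.
  have /(l_ub v w Kv) : Kj w by split=> //; rewrite le_max wM.
  by rewrite inver gt_eqF// -EFinM lee_fin ler_pdivrMr.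
exists (\sum_j L j); first by apply: sumr_ge0 => j _; have [] := L_le j.
move=> j v w Kv Vw wM; have [_ /(_ v w Kv Vw wM)] := L_le j.
move/le_trans; apply; rewrite ler_wpM2r ?powR_ge0// (bigD1 j)//= lerDl.
by apply: sumr_ge0 => i _; have [] := L_le i.
Qed.

End splitting.

(** * Finiteness of the constants and decrease of the energy *)

Section convergence.
Context {R : realType} {V : completeNormedModType R} {N : nat}.
Variables (F p : V -> R) (Vs : 'I_N -> set V) (q : R) (u0 : V).
Hypothesis F_diff : gateaux_differentiable F.
Hypothesis F_convex : convex_function [set: convex_lmodType V] F.
Hypothesis F_sc : semicoercive F p.
Hypothesis Vs_subspace : forall j, closed_subspace (Vs j).
Hypothesis Vs_sum : forall v, decompositions Vs v !=set0.
Hypothesis q_gt1 : 1 < q.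
Hypothesis F_smooth : locally_smooth F p Vs q.

Let K0 := sublevel F u0.

(** On a sublevel set the seminorm of an increment is bounded; its
representative modulo the kernel and the terms of a stable decomposition are
then bounded too, so that local smoothness applies uniformly. *)
Lemma splitting_cost_bound : exists2 L : R, 0 <= L & forall v w,
  K0 v -> K0 (v + w) -> (splitting_cost F p Vs v w <= (L * p w `^ q)%:E)%E.
Proof.
have [[sn _] _ _ _] := F_sc; have [p_ge0 pD _] := sn.
have q0 : 0 <= q by rewrite ltW// (lt_trans _ q_gt1).
have [C C0 repr] := semicoercive_representative F_sc.
have [D D0 stable] := stable_decomposition Vs_subspace Vs_sum.
have [r pr] := seminorm_sublevel_bounded u0 F_sc.
have [L L0 Lbound] :=
  local_distance_powR_bound u0 F_diff F_convex F_sc Vs_subspace q_gt1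
    (D * (C * (r + r))) F_smooth.
exists (N%:R * (L * (D * C) `^ q)).
  by rewrite mulr_ge0// mulr_ge0// powR_ge0.
move=> v w Kv Kvw.
have [pw|pw_gt0] := leP (p w) 0.
  have {}pw : p w = 0 by apply/le_anti; rewrite pw p_ge0.
  rewrite splitting_cost_ker// lee_fin mulr_ge0 ?powR_ge0// mulr_ge0//.
  by rewrite mulr_ge0// powR_ge0.
have pwr : p w <= r + r.
  have -> : w = (v + w) - v by rewrite addrC addKr.
  by rewrite (le_trans (pD _ _))// seminormN// ltW// ltrD// pr.
have [phi kphi nphi] := repr w pw_gt0.
have [w' dw' w'le] := stable (w + phi).
have w'p j : `|w' j| <= D * C * p w.
  by rewrite (le_trans (w'le j))// -mulrA ler_wpM2l// ltW.
apply: (le_trans (splitting_cost_le F v kphi dw')); rewrite lee_fin.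
have -> : N%:R * (L * (D * C) `^ q) * p w `^ q =
    \sum_(j < N) L * (D * C * p w) `^ q.
  have DC0 : 0 <= D * C by rewrite mulr_ge0// ltW.
  by rewrite sumr_const card_ord (powRM _ DC0 (p_ge0 w)); ring.
apply: ler_sum => j _; rewrite (le_trans (Lbound j v _ Kv (dw'.1 j) _))//.
  by rewrite (le_trans (w'p j))// -mulrA !ler_wpM2l// ltW.
rewrite ler_wpM2l//; apply: ge0_ler_powR => //; rewrite ?nnegrE//.
by rewrite !mulr_ge0// ltW.
Qed.

(** Where [p w = 0] the quotient is [0 / 0 = 0], and the multiplied-out bound
holds because the splitting cost itself vanishes. *)
Lemma C_K_fin : exists2 S : R, 0 <= S &
  C_K F p Vs q K0 = (q * S)%:E /\
  forall v w, K0 v -> K0 (v + w) ->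
    (splitting_cost F p Vs v w <= (S * p w `^ q)%:E)%E.
Proof.
have [[sn _] _ _ _] := F_sc; have [p_ge0 _ _] := sn.
have q0 : q != 0 by rewrite gt_eqF// (lt_trans _ q_gt1).
have [L L0 Lbound] := splitting_cost_bound.
pose quot (vw : V * V) :=
  (splitting_cost F p Vs vw.1 vw.2 / (p vw.2 `^ q)%:E)%E.
pose Q := [set quot vw | vw in [set vw : V * V | K0 vw.1 /\ K0 (vw.1 + vw.2)]].
have quot0 v w : p w = 0 -> quot (v, w) = 0%E.
  by move=> pw; rewrite /quot splitting_cost_ker// mul0e.
have ub : (ereal_sup Q <= L%:E)%E.
  apply: ge_ereal_sup => _ [[v w] /= [Kv Kvw] <-].
  have [pw|pw_gt0] := leP (p w) 0.
    by rewrite quot0 ?lee_fin//; apply/le_anti; rewrite pw p_ge0.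
  have pwq : 0 < p w `^ q by rewrite powR_gt0.
  rewrite /quot /= inver gt_eqF// lee_pdivrMr// -EFinM.
  exact: Lbound.
have lb : (0 <= ereal_sup Q)%E.
  apply: ereal_sup_ubound; exists (u0, 0); last by rewrite quot0// seminorm0.
  by rewrite /= addr0; split; exact: lexx.
have CE : C_K F p Vs q K0 = (q%:E * ereal_sup Q)%E by [].
have Q_ub v w : K0 v -> K0 (v + w) -> (quot (v, w) <= ereal_sup Q)%E.
  by move=> Kv Kvw; apply: ereal_sup_ubound; exists (v, w).
case: (ereal_sup Q) ub lb CE Q_ub => // S _; rewrite lee_fin => S0 CE Q_ub.
exists S => //; split; first by rewrite CE EFinM.
move=> v w Kv Kvw; have [pw|pw_gt0] := leP (p w) 0.
  have {}pw : p w = 0 by apply/le_anti; rewrite pw p_ge0.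
  by rewrite splitting_cost_ker// pw powR0// mulr0.
have pwq : 0 < p w `^ q by rewrite powR_gt0.
by have := Q_ub v w Kv Kvw; rewrite /quot /= inver gt_eqF// lee_pdivrMr.
Qed.

Variables (u : V) (tau : R).
Hypothesis u_min : minimizer [set: V] F u.
Hypothesis tau_adm : admissible_step F Vs tau.

(** The local corrections minimize the local energies, so replacing them by any
other ones increases the right-hand side of the admissibility inequality;
expanding around [v] yields the derivative and the local distances. *)
Lemma correction_decrease v (w w' : 'I_N -> V) :
  (forall j, minimizer (Vs j) (local_energy F ^~ v) (w j)) ->
  (forall j, Vs j (w' j)) ->
  F (v + tau *: \sum_(j < N) w j) <=
  F v + tau * ('D_(\sum_(j < N) w' j) F v +
               \sum_(j < N) local_distance F (w' j) v).
Proof.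
move=> w_min Vw'; have [tau0 adm] := tau_adm.
have Vw j : Vs j (w j) by have [] := w_min j.
rewrite (le_trans (adm v w Vw))//.
have le : \sum_(j < N) F (v + w j) <= \sum_(j < N) F (v + w' j).
  by apply: ler_sum => j _; have [_] := w_min j; apply.
have -> : \sum_(j < N) local_distance F (w' j) v =
    \sum_(j < N) F (v + w' j) - N%:R * F v - 'D_(\sum_(j < N) w' j) F v.
  rewrite gateaux_derive_sum// /local_distance /local_energy !sumrB.
  by rewrite sumr_const card_ord mulr_natl.
have := ler_wpM2l (ltW tau0) le; lra.
Qed.

(** The trial direction is the fraction [t] of the way to the minimizer, which
stays in the sublevel set by convexity.  As the infima in the splitting cost
need not be attained, the bound is proved up to any [e > 0]. *)
Lemma correction_descent S r v (w : 'I_N -> V) (t : R) :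
  (forall v w, K0 v -> K0 (v + w) ->
    (splitting_cost F p Vs v w <= (S * p w `^ q)%:E)%E) ->
  (forall v, K0 v -> p (v - u) <= r) -> 0 <= S ->
  K0 v -> (forall j, minimizer (Vs j) (local_energy F ^~ v) (w j)) ->
  0 <= t -> t <= 1 ->
  F (v + tau *: \sum_(j < N) w j) <=
  F v - tau * (t * (F v - F u) - S * (t * r) `^ q).
Proof.
move=> S_bound r_bound S0 Kv w_min t0 t1; have [tau0 _] := tau_adm.
have [[sn _] _ _ _] := F_sc; have [p_ge0 _ pZ] := sn.
have q0 : 0 <= q by rewrite ltW// (lt_trans _ q_gt1).
have Fu : F u <= F v by have [_] := u_min; apply.
set z := t *: (u - v).
have Kvz : K0 (v + z).
  rewrite /K0 /sublevel /= (le_trans _ Kv)//.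
  rewrite (le_trans (convex_function_segment _ _ F_convex t0 t1))//.
  rewrite [v + _]addrC subrK gerDl; nra.
have pz : p z `^ q <= (t * r) `^ q.
  have pzr : p z <= t * r.
    by rewrite pZ ger0_norm// ler_wpM2l// -opprB seminormN// r_bound.
  by apply: ge0_ler_powR => //; rewrite nnegrE// (le_trans _ pzr).
have Dz : 'D_z F v <= t * (F u - F v).
  rewrite gateaux_deriveZ// ler_wpM2l// lerBrDl.
  have := convex_derive_le F_convex ((F_diff v).1 (u - v)).
  by rewrite [v + (u - v)]addrC subrK.
apply/ler_addgt0Pr => e e0.
have e0' : 0 < e / tau by rewrite divr_gt0.
have [phi kphi [w' [Vw' sw'] dw']] :=
  splitting_cost_near (S_bound v z Kv Kvz) e0'.
rewrite (le_trans (correction_decrease w_min Vw'))// sw' gateaux_deriveD//.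
rewrite (derive_seminorm_ker v F_sc F_convex F_diff kphi) addr0.
have -> : F v - tau * (t * (F v - F u) - S * (t * r) `^ q) + e =
    F v + tau * (t * (F u - F v) + (S * (t * r) `^ q + e / tau)).
  by field; rewrite gt_eqF.
rewrite lerD2l ler_wpM2l// ?(ltW tau0)// lerD// (le_trans dw')// lerD2r.
by rewrite ler_wpM2l.
Qed.

End convergence.

Theorem theorem4p11 (R : realType) (V : completeNormedModType R)
    (F p : V -> R) (N : nat) (Vs : 'I_N -> set V) (u : V) (q tau : R)
    (u_ : nat -> V)
    (V_reflexive : reflexive_space (V := V))
    (F_diff : gateaux_differentiable F)
    (F_convex : convex_function [set: convex_lmodType V] F)
    (F_semicoercive : semicoercive F p)
    (Vs_subspace : forall j, closed_subspace (Vs j))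
    (Vs_sum : forall v, decompositions Vs v !=set0)
    (u_min : minimizer [set: V] F u)
    (q_gt1 : 1 < q)
    (F_smooth : locally_smooth F p Vs q)
    (tau_gt0 : 0 < tau)
    (tau_le : (tau%:E <= tau0 F Vs)%E)
    (u_seq : parallel_correction F Vs tau u_) :
  let zeta n := F (u_ n) - F u in
  let K0 := sublevel F (u_ 0%N) in
  let R0 := level_radius p K0 u in
  let CR := (C_K F p Vs q K0 * R0 `^ q)%E in
  let beta := q - 1 in
  let C := (q / tau) `^ (q - 1) * fine CR in
  ((CR < (zeta 0%N)%:E)%E ->
     zeta 1%N <= (1 - tau * (1 - q^-1)) * zeta 0%N) /\
  (~ (CR < (zeta 0%N)%:E)%E ->
     forall n, if zeta 0%N == 0 then zeta n = 0
               else zeta n <=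
                 C / (n%:R + (C / zeta 0%N) `^ (beta^-1)) `^ beta).
Proof.
move=> zeta K0 R0 CR beta C.
have q0 : 0 < q by rewrite (lt_trans _ q_gt1).
have tau_adm := admissible_step_tau0 F_convex F_diff tau_gt0 tau_le.
have [r rE r0] := level_radius_fin (u_ 0%N) u F_semicoercive.
have [S S0 [SE S_bound]] := C_K_fin (u_ 0%N) F_diff F_convex F_semicoercive
  Vs_subspace Vs_sum q_gt1 F_smooth.
pose T := q * S * r `^ q.
have CRE : CR = T%:E by rewrite /CR SE /R0 rE poweR_EFin -EFinM.
have zeta_ge0 n : 0 <= zeta n by rewrite subr_ge0; have [_] := u_min; apply.
have descent n t : K0 (u_ n) -> 0 <= t -> t <= 1 ->
    zeta n.+1 <= zeta n - tau * (t * zeta n - t `^ q * T / q).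
  move=> Kn t0 t1; have [w [w_min uE]] := u_seq n; rewrite {1}/zeta uE.
  have := correction_descent F_diff F_convex F_semicoercive q_gt1 u_min
    tau_adm S_bound (level_radius_ubound rE) S0 Kn w_min t0 t1.
  rewrite powRM// -(lerD2r (- F u)) => /le_trans; apply.
  rewrite le_eqVlt; apply/orP; left; apply/eqP.
  by rewrite /zeta /T; field; rewrite gt_eqF.
have zeta_dec n : K0 (u_ n) -> zeta n.+1 <= zeta n.
  move=> /descent/(_ (lexx _) ler01).
  by rewrite powR0 ?gt_eqF// !mul0r subr0 mulr0 subr0.
have K0_u n : K0 (u_ n).
  elim: n => [|n ih]; first exact: lexx.
  by have := zeta_dec n ih; rewrite lerD2r => /le_trans; apply.
split; rewrite CRE lte_fin => T_zeta.
  have := descent 0%N 1 (K0_u 0%N) ler01 (lexx _).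
  rewrite powR1 !mul1r => /le_trans; apply.
  have Tq : T / q <= zeta 0%N / q.
    by rewrite ler_wpM2r ?invr_ge0 ?(ltW q0)// ltW.
  have := ler_wpM2l (ltW tau_gt0) Tq; lra.
have {T_zeta} zeta0_T : zeta 0%N <= T by rewrite leNgt; apply/negP.
have zeta_le0 n : zeta n <= zeta 0%N by rewrite lerD2r; exact: K0_u.
move=> n; case: eqP => [z0|/eqP z0].
  by apply/le_anti; rewrite zeta_ge0 -z0 zeta_le0.
have z_gt0 : 0 < zeta 0%N by rewrite lt_neqAle eq_sym z0 zeta_ge0.
have T_gt0 : 0 < T by exact: lt_le_trans zeta0_T.
have C_gt0 : 0 < C by rewrite /C CRE mulr_gt0// powR_gt0// divr_gt0.
have beta_gt0 : 0 < beta by rewrite subr_gt0.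
apply: powR_decay => // m; rewrite /C CRE /=.
apply: powR_descent => // [|t t0 t1]; last exact: descent.
exact: le_trans (zeta_le0 m) zeta0_T.
Qed.
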